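(* Let $\xi$ be an absolutely continuous real random variable. Let $m$ and $n$ be positive integers, let $\mathbf{S}_n$ be a sample covariance matrix with atom variable $\xi$ and parameters $(m,n)$, and set $r:=\min\{m,n\}$. Let $v$ be any $n$-dimensional standard basis vector (one coordinate of $v$ equals $1$ and the rest are $0$), and let $\gamma\in\mathbb{R}$ with $\gamma\ne 0$. Then, with probability $1$: (1) if $\gamma>0$, then $\mathbf{S}_n(\mathbf{I} + \gamma \sqrt{-1}\, v v^* )$ has $r$ eigenvalues with positive imaginary part; and (2) if $\gamma <0$, then $\mathbf{S}_n(\mathbf{I} + \gamma \sqrt{-1}\,v v^* )$ has $r$ eigenvalues with negative imaginary part. The remaining $n-r$ eigenvalues of $\mathbf{S}_n(\mathbf{I} + \gamma \sqrt{-1}\,v v^* )$ (if any) are all equal to $0$.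
   Context: For a real random variable $\xi$, a sample covariance matrix with atom variable $\xi$ and parameters $(m,n)$ is the random $n\times n$ matrix $\mathbf{S}_n=\mathbf{X}^{\mathrm T}\mathbf{X}$, where $\mathbf{X}$ is an $m\times n$ random matrix whose entries are iid copies of $\xi$. $\mathbf{I}$ is the $n\times n$ identity matrix, $\sqrt{-1}$ is the imaginary unit, and eigenvalues are counted with algebraic multiplicity. *)

(* Defs.v *)
From HB Require Import structures.
From mathcomp Require Import all_boot all_order all_algebra.
From mathcomp Require Export complex.
From mathcomp Require Import all_classical all_reals all_analysis.

Set Implicit Arguments.
Unset Strict Implicit.
Unset Printing Implicit Defensive.
Import Order.TTheory GRing.Theory Num.Theory.

Local Open Scope classical_set_scope.
Local Open Scope ring_scope.

(* The roots of the characteristic polynomial, each repeated according to its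
   algebraic multiplicity; the order of the list is irrelevant. *)
Definition eigenvalues (F : closedFieldType) (n : nat) (A : 'M[F]_n) : seq F :=
  sval (closed_field_poly_normal (char_poly A)).

Lemma char_poly_eigenvalues (F : closedFieldType) (n : nat) (A : 'M[F]_n) :
  char_poly A = \prod_(z <- eigenvalues A) ('X - z%:P).
Proof.
rewrite /eigenvalues; case: closed_field_poly_normal => s /= {1}->.
by rewrite (monicP (char_poly_monic A)) scale1r.
Qed.

Lemma size_eigenvalues (F : closedFieldType) (n : nat) (A : 'M[F]_n) :
  size (eigenvalues A) = n.
Proof.
have := size_char_poly A.
by rewrite char_poly_eigenvalues size_prod_XsubC => -[].
Qed.

Lemma mem_eigenvalues (F : closedFieldType) (n : nat) (A : 'M[F]_n) (z : F) :
  (z \in eigenvalues A) = eigenvalue A z.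
Proof. by rewrite eigenvalue_root_char char_poly_eigenvalues root_prod_XsubC. Qed.

Definition absolutely_continuous (d : measure_display) (T : measurableType d)
    (R : realType) (P : probability T R) (xi : {RV P >-> R}) : Prop :=
  distribution P xi `<< (@lebesgue_measure R).

Definition identically_distributed (d1 d2 : measure_display)
    (T1 : measurableType d1) (T2 : measurableType d2) (R : realType)
    (P1 : probability T1 R) (P2 : probability T2 R)
    (X : {RV P1 >-> R}) (Y : {RV P2 >-> R}) : Prop :=
  forall A : set R, measurable A -> distribution P1 X A = distribution P2 Y A.

Definition mutually_independent (d : measure_display) (T : measurableType d)
    (R : realType) (P : probability T R) (I : finType)
    (X : I -> {RV P >-> R}) : Prop :=
  forall (J : {set I}) (B : I -> set R), (forall i, measurable (B i)) ->
    P (\bigcap_(i in [set` J]) (X i @^-1` B i)) =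
    (\prod_(i in J) P (X i @^-1` B i))%E.

(* The atom variable [xi] may live on another probability space: only its law
   is used. *)
Definition sample_covariance (d0 d : measure_display)
    (T0 : measurableType d0) (T : measurableType d) (R : realType)
    (P0 : probability T0 R) (xi : {RV P0 >-> R}) (P : probability T R)
    (m n : nat) (S : T -> 'M[R]_n) : Prop :=
  exists X : 'I_m * 'I_n -> {RV P >-> R},
    [/\ mutually_independent X,
        forall ij, identically_distributed (X ij) xi
      & forall w : T, let Xw := \matrix_(i < m, j < n) X (i, j) w in
          S w = Xw^T *m Xw].

(* Main.v *)
(** Write S = A^T A, B = I + gamma i v v^* with v = e_k, and r = min(m, n).  If
    u (S B) = z u with z <> 0, put y = u S and p = u A^T; then
    z |p|^2 = y B y^* = |y|^2 + i gamma |y_k|^2, so Im z has the sign of gamma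
    as soon as y_k <> 0.  If y_k = 0, then p annihilates all Krylov vectors
    (A A^T)^j A e_k; when the first r of them are independent they span the
    range of A, and this forces y = 0, a contradiction.  The multiplicity of 0
    follows from X^m chi(A^T (A B)) = X^n chi(A B A^T), one of the two products
    being invertible.  Independence of the Krylov vectors is implied by
    the non-vanishing of a polynomial in the entries of A which equals 1 at a
    bidiagonal matrix; a polynomial that is non-zero somewhere is almost surely
    non-zero at independent absolutely continuous variables, by randomizing
    the coordinates one at a time. *)

Require Import Defs.
From HB Require Import structures.
From mathcomp Require Import all_boot all_order all_algebra perm.
From mathcomp Require polyrcf.
From mathcomp Require Import all_classical all_reals all_analysis measurable_realfun.
Import Order.TTheory GRing.Theory Num.Theory.
Local Open Scope classical_set_scope.
Local Open Scope sesquilinear_scope.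
Local Open Scope ring_scope.

Set Implicit Arguments.
Unset Strict Implicit.
Unset Printing Implicit Defensive.

(** * Characteristic polynomials of the two products of rectangular matrices *)

(** Both sides equal [x ^+ n * \det N] for one block matrix [N]: [N *m U] and [V *m N] are block
    triangular. Nothing is divided by [x], so [x] may be a polynomial variable. *)
Lemma det_sub_mulmxC (L : comPzRingType) m n (x : L) (a : 'M[L]_(m, n)) (b : 'M[L]_(n, m)) :
  x ^+ n * \det (x%:M - a *m b) = x ^+ m * \det (x%:M - b *m a).
Proof.
pose N : 'M[L]_(m + n) := block_mx x%:M a b 1%:M.
pose U : 'M[L]_(m + n) := block_mx 1%:M 0 (- b) 1%:M.
pose V : 'M[L]_(m + n) := block_mx 1%:M 0 (- b) x%:M.
have NU : N *m U = block_mx (x%:M - a *m b) a 0 1%:M.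
  by rewrite mulmx_block !(mulmx1, mulmx0, mul1mx, mulmxN) addrN !add0r.
have VN : V *m N = block_mx x%:M a 0 (x%:M - b *m a).
  rewrite mulmx_block !(mulmx1, mulmx0, mul1mx, mul0mx, mulNmx) !addr0.
  by rewrite mul_mx_scalar mul_scalar_mx addNr [- _ + _]addrC.
have /(congr1 determinant) := NU.
rewrite det_mulmx det_lblock det_ublock !det1 !mulr1 => detN.
have /(congr1 determinant) := VN.
by rewrite det_mulmx det_lblock det_ublock det1 mul1r !det_scalar detN.
Qed.

Lemma char_poly_mulmxC (K : comNzRingType) m n (A : 'M[K]_(m, n)) (B : 'M[K]_(n, m)) :
  'X^n * char_poly (A *m B) = 'X^m * char_poly (B *m A).
Proof. by rewrite /char_poly /char_poly_mx !map_mxM; exact: det_sub_mulmxC. Qed.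

(** * Krylov vectors and the range of a matrix *)

Section Krylov.
Context {F : fieldType} {m n : nat}.
Implicit Types (A : 'M[F]_(m, n)) (k : 'I_n).

Definition krylov A k (j : nat) : 'cV[F]_m :=
  iter j (fun y => A *m (A^T *m y)) (col k A).

Definition krylov_mx A k p : 'M[F]_(m, p) := \matrix_(i, j) krylov A k j i 0.

Lemma krylov_mx_range A k p : exists G, krylov_mx A k p = A *m G.
Proof.
(* Column 0 of [G] is e_k; column j+1 is A^T times the j-th Krylov vector. *)
pose G : 'M[F]_(n, p) :=
  \matrix_(i, j) (if val j is j'.+1 then (A^T *m krylov A k j') i 0 else (i == k)%:R).
exists G; apply/matrixP => i j; rewrite !mxE.
case: j => -[|j] ltjp /=; last first.
  by rewrite !mxE; apply: eq_bigr => l _; rewrite [G _ _]mxE.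
rewrite mxE (bigD1 k) //= mxE eqxx mulr1 big1 ?addr0 // => l /negPf lk.
by rewrite mxE lk mulr0.
Qed.

(** The Krylov span lies in the range of A, whose dimension is at most min(m, n); equal dimensions
    force equal spaces, so A factors through the Krylov matrix. *)
Lemma krylov_full_rank A k : \rank (krylov_mx A k (minn m n)) = minn m n ->
  \rank A = minn m n /\ exists H, A = krylov_mx A k (minn m n) *m H.
Proof.
move=> rkK; have [G KAG] := krylov_mx_range A k (minn m n).
have rkA : \rank A = minn m n.
  apply/eqP; rewrite eqn_leq leq_min rank_leq_row rank_leq_col /=.
  by rewrite -{1}rkK KAG mxrankM_maxl.
split=> //.
have KA : ((krylov_mx A k (minn m n))^T <= A^T)%MS by rewrite KAG trmx_mul submxMl.
have := mxrank_leqif_sup KA; rewrite !mxrank_tr rkK rkA => /leqif_refl.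
move=> /submxP [H AH]; exists H^T.
by apply: trmx_inj; rewrite trmx_mul trmxK.
Qed.

End Krylov.

(** * The sesquilinear form of the twisted identity *)

Section TwistedForm.
Context {R : rcfType}.
Implicit Types (m n : nat) (gamma : R).

(** The squared modulus is valued in [R], so that signs are compared in an ordered field. *)
Definition sqabs (z : R[i]) : R := complex.Re z ^+ 2 + complex.Im z ^+ 2.

Definition sqnorm n (y : 'rV[R[i]]_n) : R := \sum_j sqabs (y 0 j).

Definition twist n gamma (k : 'I_n) : 'M[R[i]]_n :=
  1%:M + (real_complex R gamma * 'i%C) *: (delta_mx k 0 *m (delta_mx k (0 : 'I_1)) ^t* ).

Lemma sqabs_ge0 z : 0 <= sqabs z.
Proof. by rewrite addr_ge0 ?sqr_ge0. Qed.

Lemma sqabs_eq0 z : (sqabs z == 0) = (z == 0).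
Proof. by rewrite paddr_eq0 ?sqr_ge0 // !sqrf_eq0 eq_complex. Qed.

Lemma mul_conj_sqabs (z : R[i]) : z * z^* = real_complex R (sqabs z).
Proof. by rewrite -normCK [RHS]add_Re2_Im2. Qed.

Lemma sqnorm_ge0 n (y : 'rV_n) : 0 <= sqnorm y.
Proof. by apply: sumr_ge0 => j _; apply: sqabs_ge0. Qed.

Lemma sqnorm_eq0 n (y : 'rV_n) : (sqnorm y == 0) = (y == 0).
Proof.
apply/eqP/eqP => [/eqP|->]; last first.
  by apply: big1 => j _; apply/eqP; rewrite mxE sqabs_eq0.
rewrite psumr_eq0 => [/allP y0|j _]; last exact: sqabs_ge0.
by apply/rowP => j; apply/eqP; rewrite mxE -sqabs_eq0; apply: (implyP (y0 _ (mem_index_enum j))).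
Qed.

Lemma mulmx_trmxC_sqnorm n (y : 'rV[R[i]]_n) :
  (y *m y ^t* ) 0 0 = real_complex R (sqnorm y).
Proof.
rewrite mxE [RHS]rmorph_sum; apply: eq_bigr => j _.
by rewrite !mxE mul_conj_sqabs.
Qed.

Lemma mulmx_twist n gamma k (y : 'rV_n) :
  y *m twist gamma k = y + (real_complex R gamma * 'i%C * y 0 k) *: delta_mx 0 k.
Proof.
rewrite mulmxDr mulmx1 -scalemxAr -scalerA; congr (_ + _ *: _).
apply/rowP => j; rewrite mulmxA -colE !mxE big_ord1 !mxE eqxx /=.
by rewrite conjC_nat andbT.
Qed.

Lemma twist_form n gamma k (y : 'rV_n) :
  (y *m twist gamma k *m y ^t* ) 0 0 =
  real_complex R (sqnorm y) + real_complex R gamma * 'i%C * real_complex R (sqabs (y 0 k)).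
Proof.
rewrite mulmx_twist mulmxDl mxE mulmx_trmxC_sqnorm -scalemxAl -rowE !mxE.
by rewrite -mulrA mul_conj_sqabs.
Qed.

Lemma Re_twist_form n gamma k (y : 'rV_n) :
  complex.Re ((y *m twist gamma k *m y ^t* ) 0 0) = sqnorm y.
Proof. by rewrite twist_form /= !(mulr0, mul0r, subr0, addr0, mulr1). Qed.

Lemma Im_twist_form n gamma k (y : 'rV_n) :
  complex.Im ((y *m twist gamma k *m y ^t* ) 0 0) = gamma * sqabs (y 0 k).
Proof. by rewrite twist_form /= !(mulr0, mul0r, subr0, add0r, addr0, mulr1). Qed.

(** The real part of the form is |y|^2, whatever [gamma] is. *)
Lemma twist_form_eq0 n gamma k (y : 'rV_n) : y *m twist gamma k *m y ^t* = 0 -> y = 0.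
Proof.
move=> y0; apply/eqP; rewrite -sqnorm_eq0 -(Re_twist_form gamma k) y0.
by rewrite mxE.
Qed.

Lemma trmxC_mul m n p (y : 'M[R[i]]_(m, n)) (A : 'M[R[i]]_(n, p)) :
  (y *m A) ^t* = A ^t* *m y ^t*.
Proof. by rewrite trmx_mul map_mxM. Qed.

Lemma trmxC_real m n (A : 'M[R]_(m, n)) :
  (map_mx (real_complex R) A) ^t* = map_mx (real_complex R) A^T.
Proof.
apply/matrixP => i j; rewrite !mxE; apply/eqP.
by rewrite eq_complex /= oppr0 !eqxx.
Qed.

Lemma unitmx_eq0 (F : fieldType) n (M : 'M[F]_n) :
  (forall u : 'rV_n, u *m M = 0 -> u = 0) -> M \in unitmx.
Proof.
move=> inj; rewrite -row_free_unit -kermx_eq0; apply/eqP/row_matrixP => i.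
by rewrite row0; apply: inj; rewrite -row_mul mulmx_ker row0.
Qed.

End TwistedForm.

(** * Spectrum for a fixed matrix with independent Krylov vectors *)

Section Spectrum.
Context {R : rcfType} {m n : nat}.
Variables (A : 'M[R]_(m, n)) (k : 'I_n) (gamma : R).
Hypothesis rkA : \rank (krylov_mx A k (minn m n)) = minn m n.

Let f := real_complex R.
Let Ac := map_mx f A.
Let M := map_mx f (A^T *m A) *m twist gamma k.

Let trmxC_Ac : Ac ^t* = Ac^T.
Proof. by rewrite trmxC_real map_trmx. Qed.

Lemma mup0_char_poly_twist : mup 0 (char_poly M) = (n - minn m n)%N.
Proof.
have [rk _] := krylov_full_rank rkA.
have rkc : \rank Ac = minn m n by rewrite mxrank_map.
pose N := Ac *m twist gamma k *m Ac^T.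
have ME : M = Ac^T *m (Ac *m twist gamma k) by rewrite /M map_mxM map_trmx mulmxA.
have chi : 'X^m * char_poly M = 'X^n * char_poly N.
  by rewrite ME char_poly_mulmxC.
have unit0 (q : nat) (B : 'M[R[i]]_q) : B \in unitmx -> ~~ root (char_poly B) 0.
  rewrite -eigenvalue_root_char unitmxE unitfE => dB; apply: contra dB.
  case/eigenvalueP => u; rewrite scale0r => uB u0.
  by apply/det0P; exists u.
have mupX q (p : {poly R[i]}) : p != 0 -> mup 0 ('X^q * p) = (q + mup 0 p)%N.
  move=> p0; rewrite mupM ?expf_neq0 ?polyX_eq0 //.
  by have := @mup_XsubCX R[i] q 0 0; rewrite polyC0 subr0 eqxx => ->.
have c0 q (B : 'M[R[i]]_q) : char_poly B != 0 by rewrite monic_neq0 ?char_poly_monic.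
have := congr1 (mup 0) chi; rewrite !mupX //.
(* For m <= n, [N] is invertible: u N = 0 makes the form vanish at u A, so u A = 0, and u = 0 since
   the rows of A are free. *)
have [le_mn|/ltnW le_nm] := leqP m n.
  have freeA : row_free Ac by rewrite /row_free rkc (minn_idPl le_mn).
  have /unit0/mupNroot-> : N \in unitmx.
    apply: unitmx_eq0 => u uN; apply: (row_free_inj freeA); rewrite mul0mx.
    apply: (@twist_form_eq0 _ _ gamma k).
    by rewrite trmxC_mul trmxC_Ac !mulmxA -2!(mulmxA u) uN mul0mx.
  by rewrite addn0 => /(congr1 (subn^~ m)); rewrite addKn.
(* For n <= m, [M] itself is invertible: the twist by definiteness of its form, and A^T A because u
   A^T A = 0 gives |u A^T|^2 = 0. *)
have freeA : row_free Ac^T by rewrite /row_free mxrank_tr rkc (minn_idPr le_nm).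
rewrite subnn => _; apply/mupNroot/unit0.
rewrite /M unitmx_mul; apply/andP; split; last first.
  apply: unitmx_eq0 => u uB; apply: (@twist_form_eq0 _ _ gamma k).
  by rewrite uB mul0mx.
apply: unitmx_eq0 => u uS; apply: (row_free_inj freeA); rewrite mul0mx.
apply/eqP; rewrite -sqnorm_eq0; apply/eqP/(@complexI R).
rewrite -mulmx_trmxC_sqnorm trmxC_mul -trmxC_Ac trmxCK.
rewrite mulmxA -(mulmxA u) trmxC_Ac /Ac map_trmx -map_mxM uS mul0mx.
by rewrite mxE.
Qed.

Lemma eigenvalue_twist z : z != 0 -> eigenvalue M z ->
  exists2 c, 0 < c & complex.Im z = gamma * c.
Proof.
move=> z0 /eigenvalueP[u uM u0].
have [_ [H AKH]] := krylov_full_rank rkA.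
pose p := u *m Ac^T; pose y := p *m Ac.
have uS : u *m map_mx f (A^T *m A) = y by rewrite map_mxM -map_trmx mulmxA.
have yB : y *m twist gamma k = z *: u by rewrite -uS -mulmxA.
have y0 : y != 0.
  apply: contraNneq u0 => y0; move/eqP: yB; rewrite y0 mul0mx eq_sym scaler_eq0.
  by rewrite (negPf z0).
have yBy : y *m twist gamma k *m y ^t* = z *: (p *m p ^t* ).
  by rewrite yB -scalemxAl trmxC_mul trmxC_Ac mulmxA.
have formE : (y *m twist gamma k *m y ^t* ) 0 0 = z * f (sqnorm p).
  by rewrite yBy mxE mulmx_trmxC_sqnorm.
have p_gt0 : 0 < sqnorm p.
  rewrite lt_neqAle sqnorm_ge0 andbT eq_sym sqnorm_eq0.
  by apply: contraNneq y0 => p0; rewrite /y p0 mul0mx.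
have ImE : gamma * sqabs (y 0 k) = complex.Im z * sqnorm p.
  rewrite -Im_twist_form formE; case: (z) => a b /=.
  by rewrite mulr0 add0r.
suff yk0 : y 0 k != 0.
  exists (sqabs (y 0 k) / sqnorm p).
    by rewrite divr_gt0 // lt_neqAle sqabs_ge0 andbT eq_sym sqabs_eq0.
  by rewrite mulrA ImE mulfK ?gt_eqF.
apply: contraNneq y0 => yk0.
(* With y_k = 0 the twist fixes y, so p becomes a left eigenvector of A A^T; each Krylov step then
   only multiplies the pairing with p by z, starting from p A e_k = y_k = 0. *)
have yu : y = z *: u by rewrite -yB mulmx_twist yk0 mulr0 scale0r addr0.
have pAA : p *m Ac *m Ac^T = z *: p by rewrite -/y yu -scalemxAl.
have pL j : p *m map_mx f (krylov A k j) = 0.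
  elim: j => [|j IH]; rewrite /krylov /=.
    rewrite map_col -/Ac colE mulmxA -/y -colE.
    by apply/rowP => i; rewrite ord1 [LHS]mxE yk0 mxE.
  by rewrite -/(krylov A k j) !map_mxM -map_trmx !mulmxA pAA -scalemxAl IH scaler0.
have pK : p *m map_mx f (krylov_mx A k (minn m n)) = 0.
  apply/rowP => j; have /rowP/(_ 0) := pL j; rewrite !mxE => pLj.
  by rewrite -[RHS]pLj; apply: eq_bigr => i _; rewrite !mxE.
by rewrite /y /Ac AKH map_mxM mulmxA pK mul0mx.
Qed.

End Spectrum.

(** * Polynomial functions of a family of variables *)

(** A predicate on functions replaces multivariate polynomials: measurability and restriction to one
    coordinate follow by induction. *)
Inductive polyfun (K : pzRingType) (I : Type) : ((I -> K) -> K) -> Prop :=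
| polyfun_cst c : polyfun (fun=> c)
| polyfun_coord i : polyfun (fun x => x i)
| polyfunD f g : polyfun f -> polyfun g -> polyfun (fun x => f x + g x)
| polyfunM f g : polyfun f -> polyfun g -> polyfun (fun x => f x * g x).

Section Polyfun.
Context {K : pzRingType} {I : Type}.

Lemma polyfun_sum (J : Type) (s : seq J) (p : pred J) (F : J -> (I -> K) -> K) :
  (forall j, polyfun (F j)) -> polyfun (fun x => \sum_(j <- s | p j) F j x).
Proof.
move=> polyF; elim: s => [|j s IH].
  by under eq_fun do rewrite big_nil; exact: polyfun_cst.
under eq_fun do rewrite big_cons; case: (p j) => //.
exact: polyfunD.
Qed.

Lemma polyfun_prod (J : Type) (s : seq J) (p : pred J) (F : J -> (I -> K) -> K) :
  (forall j, polyfun (F j)) -> polyfun (fun x => \prod_(j <- s | p j) F j x).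
Proof.
move=> polyF; elim: s => [|j s IH].
  by under eq_fun do rewrite big_nil; exact: polyfun_cst.
under eq_fun do rewrite big_cons; case: (p j) => //.
exact: polyfunM.
Qed.

Lemma polyfun_mulmx m n p (A : (I -> K) -> 'M[K]_(m, n)) (B : (I -> K) -> 'M[K]_(n, p)) :
  (forall i j, polyfun (fun x => A x i j)) -> (forall i j, polyfun (fun x => B x i j)) ->
  forall i j, polyfun (fun x => (A x *m B x) i j).
Proof.
move=> pA pB i j; under eq_fun do rewrite mxE.
by apply: polyfun_sum => l; apply: polyfunM.
Qed.

Lemma polyfun_det n (A : (I -> K) -> 'M[K]_n) :
  (forall i j, polyfun (fun x => A x i j)) -> polyfun (fun x => \det (A x)).
Proof.
move=> pA; apply: polyfun_sum => s; apply: polyfunM; first exact: polyfun_cst.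
by apply: polyfun_prod => i; apply: pA.
Qed.

End Polyfun.

Definition update (I : eqType) (K : Type) (x : I -> K) (i : I) (t : K) : I -> K :=
  fun j => if j == i then t else x j.

(** Used to bound sections of the zero set: a non-zero [p] has finitely many roots. *)
Lemma polyfun_update (K : comNzRingType) (I : eqType) (f : (I -> K) -> K) :
  polyfun f -> forall x i, exists p : {poly K}, forall t, f (update x i t) = p.[t].
Proof.
move=> pf x i; elim: pf => [c|j|g h _ [p gp] _ [q hq]|g h _ [p gp] _ [q hq]].
- by exists c%:P => t; rewrite hornerC.
- rewrite /update; have [_|_] := eqVneq j i; first by exists 'X => t; rewrite hornerX.
  by exists (x j)%:P => t; rewrite hornerC.
- by exists (p + q) => t; rewrite gp hq hornerD.
- by exists (p * q) => t; rewrite gp hq hornerM.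
Qed.

Lemma measurable_polyfun (R : realType) (I : Type) (f : (I -> R) -> R)
    (d : measure_display) (T : measurableType d) (X : T -> I -> R) :
  polyfun f -> (forall i, measurable_fun setT (X ^~ i)) ->
  measurable_fun setT (fun w => f (X w)).
Proof.
move=> pf mX; elim: pf => [c|j|g h _ mg _ mh|g h _ mg _ mh].
- exact: measurable_cst.
- exact: mX.
- exact: measurable_funD.
- exact: measurable_funM.
Qed.

(** * Independence and almost sure non-vanishing *)

Section Independence.
Context (R : realType) (d : measure_display) (T : measurableType d) (P : probability T R).

(** A product measure is determined by its values on rectangles, where independence gives the joint
    law. *)
Lemma independent_joint_law (d1 d2 : measure_display) (T1 : measurableType d1)
    (T2 : measurableType d2) (Y : {mfun T >-> T1}) (Z : {mfun T >-> T2}) :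
  (forall A B, measurable A -> measurable B ->
    P (Y @^-1` A `&` Z @^-1` B) = (P (Y @^-1` A) * P (Z @^-1` B))%E) ->
  forall D, measurable D ->
  (distribution P Y \x distribution P Z)%E D = P ((fun w => (Y w, Z w)) @^-1` D).
Proof.
move=> indep D mD.
have mYZ : measurable_fun setT (fun w => (Y w, Z w)) by exact/measurable_fun_pairP.
pose YZ : {mfun T >-> (T1 * T2)%type} := mfun_Sub (mem_set mYZ).
by rewrite (@product_measure_unique _ _ _ _ _ _ _ (distribution P YZ)).
Qed.

Context (I : finType) (X : I -> {RV P >-> R}).
Hypothesis indepX : mutually_independent X.

(** A family stable under intersection that generates the sigma-algebra of the coordinates in
    [J]. *)
Definition cylinders (J : {set I}) : set (set T) :=
  [set A | exists2 B : I -> set R, (forall i, measurable (B i)) &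
    A = \bigcap_(i in [set` J]) (X i @^-1` B i)].

Lemma cylinders_measurable J A : <<s cylinders J >> A -> measurable A.
Proof.
apply: smallest_sub; first exact: sigma_algebra_measurable.
move=> _ [B mB ->]; apply: fin_bigcap_measurable => // i _.
by rewrite -[X in measurable X]setTI; apply: measurable_funP.
Qed.

Lemma cylinders_coord (J : {set I}) i B : i \in J -> measurable B ->
  cylinders J (X i @^-1` B).
Proof.
move=> iJ mB; exists (fun j => if j == i then B else setT).
  by move=> j; case: ifP.
rewrite eqEsubset; split=> w.
  by move=> wB j jJ /=; case: eqP => // ->.
by move=> /(_ i iJ) /=; rewrite eqxx.
Qed.

(** Both sides are finite measures in [A] that agree on the cylinders, hence on the sigma-algebra
    these generate. *)
Lemma independent_cylinders (J : {set I}) i A B : i \notin J ->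
  <<s cylinders J >> A -> measurable B ->
  P (A `&` X i @^-1` B) = (P A * P (X i @^-1` B))%E.
Proof.
move=> iJ sA mB.
have mXB j C : measurable C -> measurable (X j @^-1` C).
  by move=> mC; rewrite -[X in measurable X]setTI; apply: measurable_funP.
have PB_fin : P (X i @^-1` B) \is a fin_num by rewrite fin_num_measure //; exact: mXB.
pose r : {nonneg R} := NngNum (fine_ge0 (measure_ge0 P (X i @^-1` B))).
suff: mrestr P (mXB i B mB) A = mscale r P A.
  by rewrite /mrestr /mscale /= fineK // muleC.
apply: (g_sigma_algebra_measure_unique (cylinders J) _ (fun=> setT)) => //.
- by move=> C GC; apply: (@cylinders_measurable J); apply: sub_sigma_algebra.
- by move=> _; exists (fun=> setT) => //; rewrite bigcapT.
- by rewrite bigcup_const.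
- move=> _ _ [B1 mB1 ->] [B2 mB2 ->]; exists (fun j => B1 j `&` B2 j).
    by move=> j; apply: measurableI.
  by rewrite -bigcapI.
- move=> _ [B' mB' ->]; rewrite /= /mrestr /mscale /= fineK // muleC.
  (* Inserting [B] at index [i] turns the intersection into a single cylinder over [i |: J], to
     which mutual independence applies. *)
  pose C j := if j == i then B else B' j.
  have mC j : measurable (C j) by rewrite /C; case: ifP.
  have C_i : C i = B by rewrite /C eqxx.
  have C_J j : j \in J -> C j = B' j.
    by move=> jJ; rewrite /C; case: eqP jJ iJ => // -> ->.
  transitivity (P (\bigcap_(j in [set` i |: J]) (X j @^-1` C j))).
    congr (P _); rewrite eqEsubset; split=> w.
      move=> [wJ wi] j /=; rewrite !inE => /orP[/eqP->|jJ]; rewrite ?C_i //.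
      by rewrite C_J //; exact: wJ.
    move=> wC; split; last by rewrite -C_i; apply: wC; rewrite /= setU11.
    by move=> j jJ; rewrite -C_J //; apply: wC; rewrite /= setU1r.
  rewrite indepX // big_setU1 //= C_i muleC; congr (_ * _)%E.
  by rewrite indepX //; apply: eq_bigr => j jJ; rewrite C_J.
- by move=> _; rewrite /= /mrestr setTI ltey_eq PB_fin.
Qed.

Hypothesis acX : forall i, absolutely_continuous (X i).

(** Hybrid point, random on [s] and frozen at [x0] elsewhere; it moves from [x0] to the full random
    vector as [s] grows. *)
Let mix (x0 : I -> R) (s : seq I) (w : T) : I -> R :=
  fun j => if j \in s then X j w else x0 j.

Let mix_cons x0 i s w : mix x0 (i :: s) w = update (mix x0 s w) i (X i w).
Proof. by apply/funext => j; rewrite /mix /update in_cons; case: eqVneq => [->|]. Qed.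

Lemma distribution_roots0 i (p : {poly R}) (A : set R) : p != 0 ->
  measurable A -> (forall t, A t -> p.[t] = 0) -> distribution P (X i) A = 0%E.
Proof.
move=> p0 mA Ap; have := acX i; apply; first last; [exact: Ap|exact: mA|].
(* Null sets are those whose measurable subsets [B] all have measure zero; here [B] consists of
   roots of [p], so it is finite. *)
move=> B mB Bp.
apply/countable_lebesgue_measure0/finite_set_countable.
apply: (sub_finite_set Bp); apply/finite_seqP; exists (polyrcf.rootsR p).
by apply/seteqP; split=> t /=; rewrite -polyrcf.roots_on_rootsR // in_itv /= => /rootP.
Qed.

(* The step from [s] to [i :: s] is Fubini: given the coordinates in [s], [f] is
   a non-zero univariate polynomial in the [i]-th coordinate. *)
Let mix_null (f : (I -> R) -> R) x0 s : polyfun f -> f x0 != 0 -> uniq s ->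
  P [set w | f (mix x0 s w) = 0] = 0%E.
Proof.
move=> pf fx0; elim: s => [_|i s IH /= /andP[i_s /IH {}IH]].
  rewrite (_ : [set _ | _] = set0) ?measure0 // -subset0 => w /= /eqP.
  by rewrite (negPf fx0).
pose J := [set j in s].
have iJ : i \notin J by rewrite inE.
have mY : measurable_fun setT (id : T -> g_sigma_algebraType (cylinders J)).
  by move=> _ A /cylinders_measurable; rewrite setTI.
(* The identity into the coarser sigma-algebra plays the role of the random vector of the
   coordinates in [s]. *)
pose Y : {mfun T >-> g_sigma_algebraType (cylinders J)} := mfun_Sub (mem_set mY).
have mmix j : measurable_fun setT
    (fun w : g_sigma_algebraType (cylinders J) => mix x0 s w j).
  rewrite /mix; case: (boolP (j \in s)) => js; last exact: measurable_cst.
  move=> _ B mB; rewrite setTI; apply: sub_sigma_algebra.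
  by apply: cylinders_coord => //; rewrite inE.
(* [D] is the new part of the zero set: [f] is non-zero before coordinate [i] is randomized and zero
   after. *)
pose D : set (g_sigma_algebraType (cylinders J) * R) :=
  [set p | f (mix x0 s p.1) != 0 /\ f (update (mix x0 s p.1) i p.2) = 0].
have m0 : measurable [set (0 : R)] by exact: measurable_set1.
have mD : measurable D.
  have mf1 : measurable_fun setT
      (fun q : g_sigma_algebraType (cylinders J) * R => f (mix x0 s q.1)).
    apply: measurable_polyfun => // j.
    exact: (measurableT_comp (mmix j) measurable_fst).
  have mf2 : measurable_fun setT
      (fun q : g_sigma_algebraType (cylinders J) * R => f (update (mix x0 s q.1) i q.2)).
    apply: measurable_polyfun => // j; rewrite /update.
    case: (j == i); first exact: measurable_snd.
    exact: (measurableT_comp (mmix j) measurable_fst).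
  rewrite (_ : D = (fun q => f (mix x0 s q.1)) @^-1` (~` [set 0]) `&`
                   (fun q => f (update (mix x0 s q.1) i q.2)) @^-1` [set 0]); last first.
    by apply/seteqP; split=> q /= [/eqP].
  apply: measurableI.
    by rewrite -[X in measurable X]setTI; apply: mf1 => //; apply: measurableC.
  by rewrite -[X in measurable X]setTI; apply: mf2.
have D0 : (distribution P Y \x distribution P (X i))%E D = 0%E.
  apply: integral0_eq => w _ /=.
  have [p fp] := polyfun_update pf (mix x0 s w) i.
  have mDw : measurable (xsection D w) by apply: measurable_xsection.
  have [fw0|fw0] := eqVneq (f (mix x0 s w)) 0.
    rewrite (_ : xsection D w = set0) ?measure0 // -subset0 => t.
    by rewrite /xsection /= inE => -[/= /eqP].
  apply: (@distribution_roots0 _ p) => //.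
    (* Writing back the current value of coordinate [i] changes nothing, so [p] takes there the
       non-zero value of [f]. *)
    apply: contra_neq fw0 => p0; have := fp (mix x0 s w i).
    rewrite p0 horner0 => <-; congr f; apply/funext => j.
    by rewrite /update; case: eqVneq => [->|].
  by move=> t; rewrite /xsection /= inE => -[_ /=]; rewrite fp.
have := @independent_joint_law _ _ _ _ Y (X i) _ D mD.
rewrite D0 => PD.
have mfs s' : measurable [set w | f (mix x0 s' w) = 0].
  rewrite (_ : [set _ | _] = (fun w => f (mix x0 s' w)) @^-1` [set 0]) //.
  rewrite -[X in measurable X]setTI; apply: measurable_polyfun => // j.
  by rewrite /mix; case: (j \in s').
apply/negligibleP => //.
apply: (@negligibleS _ _ _ _ ([set w | f (mix x0 s w) = 0] `|`
                              (fun w => (Y w, X i w)) @^-1` D)).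
  move=> w /=; rewrite mix_cons => fw.
  by have [fw0|fw0] := eqVneq (f (mix x0 s w)) 0; [left|right].
apply: negligibleU; first exact/negligibleP.
apply/negligibleP; last first.
  by apply/esym/PD => A B sA mB; apply: (independent_cylinders iJ).
have mYX : measurable_fun setT (fun w => (Y w, X i w)) by exact: measurable_fun_pair.
by rewrite -[X in measurable X]setTI; apply: mYX.
Qed.

Lemma polyfun_ae_neq0 (f : (I -> R) -> R) x0 : polyfun f -> f x0 != 0 ->
  {ae P, forall w, f (X ^~ w) != 0}.
Proof.
move=> pf fx0; have := mix_null pf fx0 (enum_uniq I).
have mixE w : mix x0 (enum I) w = X ^~ w.
  by apply/funext => j; rewrite /mix mem_enum.
under eq_set do rewrite mixE.
move/negligibleP => nf; apply: negligibleS (nf _) => [w /=|].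
  by move/negP; rewrite negbK => /eqP.
rewrite (_ : [set _ | _] = (fun w => f (X ^~ w)) @^-1` [set 0]) //.
by rewrite -[X in measurable X]setTI; apply: measurable_polyfun.
Qed.

End Independence.

(** * A Krylov minor and a matrix where it equals 1 *)

Section KrylovMinor.
Context {F : fieldType} {m n : nat}.
Implicit Types (A : 'M[F]_(m, n)) (k : 'I_n).

(** The rows are the Krylov vectors cut to their first min(m, n) entries; this layout is lower
    triangular at the bidiagonal matrix. *)
Definition krylov_minor A k : F :=
  \det (\matrix_(j < minn m n, i < minn m n)
          krylov A k j (widen_ord (geq_minl m n) i) 0).

Lemma krylov_minor_rank A k : krylov_minor A k != 0 ->
  \rank (krylov_mx A k (minn m n)) = minn m n.
Proof.
rewrite /krylov_minor; set B := (\matrix_(_, _) _) => detB.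
have BE : B^T = rowsub (widen_ord (geq_minl m n)) (krylov_mx A k (minn m n)).
  by apply/matrixP => i j; rewrite !mxE.
apply/eqP; rewrite eqn_leq rank_leq_col /=.
have /mxrank_unit {1}<- : B^T \in unitmx by rewrite unitmx_tr unitmxE unitfE.
by rewrite BE rowsubE mxrankM_maxr.
Qed.

(* [k0] stands for the index 0, so the transposition moves column [k] to the front. *)
Definition bidiagonal (k k0 : 'I_n) : 'M[F]_(m, n) :=
  \matrix_(i, j) (((tperm k k0 j : nat) == i) || ((tperm k k0 j : nat) == i.+1))%:R.

(** Up to the transposition of columns, Z^T sends y to y_l + y_(l-1), which moves the leading 1 one
    place down, and Z sends w to w_i + w_(i+1), which keeps it there. *)
Lemma krylov_bidiagonal k k0 j : k0 = 0%N :> nat ->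
  (forall i : 'I_m, (j < i)%N -> krylov (bidiagonal k k0) k j i 0 = 0) /\
  (forall i : 'I_m, i = j :> nat -> (i < n)%N -> krylov (bidiagonal k k0) k j i 0 = 1).
Proof.
move=> k00; set Z := bidiagonal k k0; elim: j => [|j [IH0 IH1]].
  by split=> i; rewrite /krylov /= !mxE tpermL k00; case: (i : nat).
set y := krylov Z k j in IH0 IH1 *.
have krylovS : krylov Z k j.+1 = Z *m (Z^T *m y) by [].
have w0 l : (j.+1 < tperm k k0 l)%N -> (Z^T *m y) l 0 = 0.
  move=> lj; rewrite mxE big1 // => i _; rewrite !mxE.
  have [ij|ij] := ltnP j i; first by rewrite IH0 ?mulr0.
  by rewrite !gtn_eqF ?mul0r // (leq_ltn_trans _ lj) // ltnW.
have w1 l : tperm k k0 l = j.+1 :> nat -> (j < m)%N -> (Z^T *m y) l 0 = 1.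
  move=> lj jm; rewrite mxE (bigD1 (Ordinal jm)) //= big1 => [|i ij].
    rewrite addr0 IH1 //= ?mulr1 ?mxE ?lj ?eqxx ?orbT //.
    by rewrite (leq_ltn_trans (leqnSn j)) // -lj.
  rewrite !mxE lj eqSS; have [ji|ij'] := ltnP j i; first by rewrite IH0 ?mulr0.
  rewrite !gtn_eqF ?mul0r ?ltnS // ltn_neqAle ij' andbT.
  by apply: contraNneq ij => ij; apply/eqP/val_inj.
split=> i ij; rewrite krylovS mxE.
  rewrite big1 // => l _; rewrite [Z _ _]mxE.
  case: eqVneq => [li|_] /=; first by rewrite w0 ?mulr0 // li.
  case: eqVneq => [li|_] /=; last by rewrite mul0r.
  by rewrite w0 ?mulr0 // li ltnW.
move=> i_n; have jm : (j < m)%N by rewrite (leq_trans _ (ltn_ord i)) // ij.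
(* Row [i] of Z has ones only at permuted positions i and i+1; [l0] is the first, and [w0] kills the
   second. *)
pose l0 := tperm k k0 (Ordinal i_n).
have l0E : tperm k k0 l0 = Ordinal i_n by rewrite /l0 tpermK.
rewrite (bigD1 l0) //= [Z _ _]mxE l0E eqxx mul1r w1 ?l0E //= big1 ?addr0 // => l ll0.
rewrite [Z _ _]mxE; case: eqVneq => [li|_] /=.
  by case/eqP: ll0; rewrite /l0 -[LHS](tpermK k k0); congr (tperm k k0 _); apply: val_inj.
case: eqVneq => [li|_] /=; last by rewrite mul0r.
by rewrite w0 ?mulr0 // li ij.
Qed.

Lemma krylov_minor_bidiagonal k k0 : k0 = 0%N :> nat ->
  krylov_minor (bidiagonal k k0) k = 1.
Proof.
move=> k00; rewrite /krylov_minor det_trig.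
  apply: big1 => i _; rewrite mxE; apply: (krylov_bidiagonal k i k00).2 => //=.
  exact: leq_trans (ltn_ord i) (geq_minr m n).
apply/is_trig_mxP => j i ji; rewrite mxE.
exact: (krylov_bidiagonal k j k00).1.
Qed.

Lemma polyfun_krylov_minor k :
  polyfun (fun x : 'I_m * 'I_n -> F => krylov_minor (\matrix_(i, j) x (i, j)) k).
Proof.
apply: polyfun_det => j i; under eq_fun do rewrite mxE.
move: (widen_ord _ i) => {}i; elim: (j : nat) i => [|l IH] i.
  by under eq_fun do rewrite /krylov /= !mxE; exact: polyfun_coord.
apply: polyfun_mulmx => [a b|a b].
  by under eq_fun do rewrite mxE; exact: polyfun_coord.
apply: polyfun_mulmx => [a' b'|a' b'].
  by under eq_fun do rewrite !mxE; exact: polyfun_coord.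
by rewrite (ord1 b'); exact: IH.
Qed.

End KrylovMinor.

(** * Counting eigenvalues, and the almost sure statement *)

(** All non-zero eigenvalues have imaginary part of the sign of [gamma], so it suffices to count
    them: n minus the multiplicity of 0. *)
Lemma count_eigenvalues_twist (R : realType) m n (A : 'M[R]_(m, n)) (k : 'I_n) gamma
    (M := map_mx (real_complex R) (A^T *m A) *m twist gamma k) :
  gamma != 0 -> krylov_minor A k != 0 ->
  [/\ 0 < gamma -> count (fun z => 0 < complex.Im z) (eigenvalues M) = minn m n,
      gamma < 0 -> count (fun z => complex.Im z < 0) (eigenvalues M) = minn m n
    & count_mem 0 (eigenvalues M) = (n - minn m n)%N].
Proof.
move=> gamma0 /krylov_minor_rank rkA.
have count0 : count_mem 0 (eigenvalues M) = (n - minn m n)%N.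
  by rewrite -mu_prod_XsubC -char_poly_eigenvalues mup0_char_poly_twist.
have countN0 : count (predC (pred1 0)) (eigenvalues M) = minn m n.
  have := count_predC (pred1 0) (eigenvalues M).
  rewrite count0 size_eigenvalues => /(congr1 (subn^~ (n - minn m n)%N)).
  by rewrite addKn subKn // geq_minr.
split=> // gamma_sign; rewrite -countN0; apply: eq_in_count => z;
  rewrite mem_eigenvalues => eig_z /=; have [->|z0] := eqVneq z 0;
  rewrite ?ltxx //; have [c c0 ->] := eigenvalue_twist rkA z0 eig_z.
- by rewrite mulr_gt0.
- by rewrite nmulr_rlt0.
Qed.

Unset Implicit Arguments.

Theorem theorem2p3 (R : realType)
    (d0 : measure_display) (T0 : measurableType d0) (P0 : probability T0 R)
    (xi : {RV P0 >-> R}) (hxi : absolutely_continuous xi)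
    (d : measure_display) (T : measurableType d) (P : probability T R)
    (m n : nat) (hm : (0 < m)%N) (hn : (0 < n)%N)
    (S : T -> 'M[R]_n) (hS : sample_covariance xi P m S)
    (v : 'cV[R[i]%C]_n) (hv : exists k : 'I_n, v = delta_mx k 0)
    (gamma : R) (hgamma : gamma != 0) :
  let r := minn m n in
  let M (w : T) : 'M[R[i]%C]_n :=
    map_mx (real_complex R) (S w)
      *m (1%:M + (real_complex R gamma * 'i%C) *: (v *m v ^t* )) in
  {ae P, forall w,
    [/\ 0 < gamma -> count (fun z => 0 < complex.Im z) (eigenvalues (M w)) = r,
        gamma < 0 -> count (fun z => complex.Im z < 0) (eigenvalues (M w)) = r
      & count_mem 0 (eigenvalues (M w)) = (n - r)%N]}.
Proof.
move=> r M; have [X [indepX idX SE]] := hS; have [k vE] := hv.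
pose B : 'M[R]_(m, n) := bidiagonal k (Ordinal hn).
pose x0 (ij : 'I_m * 'I_n) := B ij.1 ij.2.
(* Absolute continuity depends only on the law, which each entry shares with [xi]. *)
have acX ij : absolutely_continuous (X ij).
  by move=> A nullA C mC CA; rewrite idX //; exact: (hxi A nullA C mC CA).
have x0_minor : krylov_minor (\matrix_(i, j) x0 (i, j)) k != 0.
  rewrite (_ : (\matrix_(_, _) _) = B) ?krylov_minor_bidiagonal ?oner_neq0 //.
  by apply/matrixP => i j; rewrite mxE.
apply: filterS (polyfun_ae_neq0 indepX acX (polyfun_krylov_minor k) x0_minor) => w minor0.
by rewrite /M SE vE; exact: count_eigenvalues_twist.
Qed.
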